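(* In the MNL setting of the context, assume $\|x_{ti}\|_2\le1$ for all $t,i$ and $\|\mathbf{w}^\star\|_2\le B$, and let $\hat\lambda=\frac{1}{8B^2}$. For $t\ge1$ let $\boldsymbol{\nu}_t^\star$ be a point such that $$\tfrac12\|\mathbf{w}^\star-\hat{\mathbf{w}}_t\|^2_{\nabla^2\mathcal{L}_t(\boldsymbol{\nu}_t^\star)}=\|\mathbf{w}^\star-\hat{\mathbf{w}}_t\|^2_{\int_0^1(1-v)\nabla^2\mathcal{L}_t(\hat{\mathbf{w}}_t+v(\mathbf{w}^\star-\hat{\mathbf{w}}_t))\,dv},$$ and let $\hat H_t(\boldsymbol{\nu}_t^\star)=\nabla^2\mathcal{L}_t(\boldsymbol{\nu}_t^\star)+\hat\lambda\mathbf{I}_d$. Then for every $t\ge1$, if $\mathbf{w}^\star\in\hat{\mathcal{C}}_t(\delta)$, we have $$\|\mathbf{w}^\star-\hat{\mathbf{w}}_t\|^2_{\hat H_t(\boldsymbol{\nu}_t^\star)}\le2\hat\beta_t(\delta)^2+1 = O(d\log(Bt)),$$ where the $O(\cdot)$ holds for $B\ge 1$, $t\ge2$ with a constant depending only on $\delta$.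
   Context: $\|x\|_A=\sqrt{x^\top Ax}$; $\mathcal{W}=\{\mathbf{w}\in\mathbb{R}^d:\|\mathbf{w}\|_2\le B\}$, $B>0$; $\delta\in(0,1]$. At each round $s$ there are features $x_{si}\in\mathbb{R}^d$, $i\in[N]$, an offered set $S_s\subseteq[N]$ with $|S_s|\le K$, and a choice vector $(y_{si})_{i\in S_s\cup\{0\}}\in\{0,1\}^{|S_s|+1}$ with exactly one entry equal to $1$ ($0$ is the outside option, $x_{s0}=\mathbf0$). For $i\in S\cup\{0\}$, $p_s(i\mid S,\mathbf{w})=\exp(x_{si}^\top\mathbf{w})/(1+\sum_{j\in S}\exp(x_{sj}^\top\mathbf{w}))$. Put $\ell_s(\mathbf{w})=-\sum_{i\in S_s\cup\{0\}}y_{si}\log p_s(i\mid S_s,\mathbf{w})$, $\mathcal{L}_t(\mathbf{w})=\sum_{s=1}^{t-1}\ell_s(\mathbf{w})$, $\hat{\mathbf{w}}_t\in\arg\min_{\mathbf{w}\in\mathcal{W}}\mathcal{L}_t(\mathbf{w})$, $$\hat\beta_t(\delta)^2=\log\frac1\delta+d\log\left(\max\left\{e,\frac{4eB(t-1)}{d}\right\}\right),\qquad \hat{\mathcal{C}}_t(\delta)=\{\mathbf{w}\in\mathcal{W}:\mathcal{L}_t(\mathbf{w})-\mathcal{L}_t(\hat{\mathbf{w}}_t)\le\hat\beta_t(\delta)^2\}.$$ *)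

(* Defs.v *)
From mathcomp Require Import all_boot all_order all_algebra.
From mathcomp Require Import all_classical all_reals all_analysis.
Import Order.TTheory GRing.Theory Num.Theory numFieldNormedType.Exports.

Set Implicit Arguments.
Unset Strict Implicit.
Unset Printing Implicit Defensive.

Local Open Scope classical_set_scope.
Local Open Scope ring_scope.

(* The norm carried by 'cV[R]_d in the library is the sup norm, so the
   Euclidean norm and the weighted norm |x|_A are defined explicitly. *)
Definition norm2 (R : realType) (d : nat) (x : 'cV[R]_d) : R :=
  Num.sqrt (\sum_(i < d) x i 0 ^+ 2).

Definition mxnorm (R : realType) (d : nat) (A : 'M[R]_d) (x : 'cV[R]_d) : R :=
  Num.sqrt ((x^T *m A *m x) 0 0).

Definition hessian (R : realType) (d : nat) (f : 'cV[R]_d -> R)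
    (w : 'cV[R]_d) : 'M[R]_d :=
  \matrix_(i < d, j < d)
    'D_(delta_mx i 0 : 'cV[R]_d)
      (fun u : 'cV[R]_d => 'D_(delta_mx j 0 : 'cV[R]_d) f u) w.

Definition mxintegral01 (R : realType) (d : nat) (A : R -> 'M[R]_d) : 'M[R]_d :=
  \matrix_(i < d, j < d)
    Rintegral (@lebesgue_measure R) `[0, 1] (fun v : R => A v i j).

Definition ball2 (R : realType) (d : nat) (B : R) : set 'cV[R]_d :=
  [set w | norm2 w <= B].

(* An option 'I_N is an item of [N] (Some i) or the outside option (None),
   whose feature vector is 0. *)
Definition feature (R : realType) (d N : nat) (x : nat -> 'I_N -> 'cV[R]_d)
    (s : nat) (i : option 'I_N) : 'cV[R]_d :=
  if i is Some j then x s j else 0.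

Definition choices (N : nat) (S : {set 'I_N}) : {set option 'I_N} :=
  None |: [set Some i | i in S].

Definition mnl_prob (R : realType) (d N : nat) (x : nat -> 'I_N -> 'cV[R]_d)
    (s : nat) (i : option 'I_N) (S : {set 'I_N}) (w : 'cV[R]_d) : R :=
  expR (((feature x s i)^T *m w) 0 0) /
  (1 + \sum_(j in S) expR (((x s j)^T *m w) 0 0)).

(* Only the entries of y s on choices (S s) are relevant. *)
Definition round_loss (R : realType) (d N : nat) (x : nat -> 'I_N -> 'cV[R]_d)
    (S : nat -> {set 'I_N}) (y : nat -> option 'I_N -> bool)
    (s : nat) (w : 'cV[R]_d) : R :=
  - \sum_(i in choices (S s)) (y s i)%:R * ln (mnl_prob x s i (S s) w).

Definition cum_loss (R : realType) (d N : nat) (x : nat -> 'I_N -> 'cV[R]_d)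
    (S : nat -> {set 'I_N}) (y : nat -> option 'I_N -> bool)
    (t : nat) (w : 'cV[R]_d) : R :=
  \sum_(1 <= s < t) round_loss x S y s w.

Definition argmin_on (R : realType) (T : Type) (W : set T) (f : T -> R) : set T :=
  [set w | W w /\ forall u, W u -> f w <= f u].

Definition betasq (R : realType) (d : nat) (B : R) (t : nat) (delta : R) : R :=
  ln (1 / delta) +
  d%:R * ln (Num.max (expR 1) (4 * expR 1 * B * (t%:R - 1) / d%:R)).

Definition conf_set (R : realType) (d : nat) (B : R) (L : 'cV[R]_d -> R)
    (what : 'cV[R]_d) (t : nat) (delta : R) : set 'cV[R]_d :=
  [set w | ball2 B w /\ L w - L what <= betasq d B t delta].

(* Main.v *)
(* Along the segment v |-> what + v z, z = wstar - what, the antiderivative of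
   (1 - v) g''(v), for g v = L (what + v z), is g v + (1 - v) g' v.  Hence the
   quadratic form of the integrated Hessian at z equals
   L wstar - L what - <grad L what, z>.  The linear term is nonnegative because
   what minimises L on the convex ball, so the form is at most betasq.  The
   regularisation adds lambda |z|^2 <= 4 B^2 / (8 B^2) = 1/2.  For the O(.) part,
   ln (B t) >= ln 2 absorbs the constants. *)
Require Import Defs.
From mathcomp Require Import all_boot all_order all_algebra.
From mathcomp Require Import all_classical all_reals all_analysis.
From mathcomp Require Import ring lra.
Import Order.TTheory GRing.Theory Num.Theory numFieldNormedType.Exports.
Local Open Scope classical_set_scope.
Local Open Scope ring_scope.

Section RegularizedQuadraticBound.
Context (R : realType).
Local Notation dotp u v := (((u)^T *m v) 0 0).

(** * Directional derivatives through restriction to lines *)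

(** The two difference quotients agree as functions of [h], so both existence and value of the
    derivative transfer by rewriting, with no limit argument. *)
Lemma line_quotient d (f : 'cV[R]_d -> R) (a z : 'cV[R]_d) (t : R) :
  (fun h : R => h^-1 *:
    (((fun v : R => f (a + v *: z)) \o shift t) (h *: (1 : R)) -
      f (a + t *: z))) =
  (fun h : R => h^-1 *: ((f \o shift (a + t *: z)) (h *: z) - f (a + t *: z))).
Proof.
apply/funext => h; congr (_ *: (f _ - _)) => /=.
by rewrite [h *: 1]mulr1 scalerDl addrCA addrA.
Qed.

(* The chain and quotient rules are only available for functions R -> R; this
   transports them to directional derivatives. *)
Lemma is_derive_line d (f : 'cV[R]_d -> R) (a z : 'cV[R]_d) (t df : R) :
  is_derive t 1 (fun v : R => f (a + v *: z)) df <->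
  is_derive (a + t *: z) z f df.
Proof.
have q := line_quotient d f a z t.
by split=> -[]; rewrite /derivable /derive /= ?q => c e; split;
  rewrite /derivable /derive /= ?q.
Qed.

Lemma is_derive_at0 d (f : 'cV[R]_d -> R) (w z : 'cV[R]_d) (df : R) :
  is_derive (0 : R) 1 (fun v : R => f (w + v *: z)) df <->
  is_derive w z f df.
Proof. by rewrite is_derive_line scale0r addr0. Qed.

Lemma is_derive_chain d (g : R -> R) (f : 'cV[R]_d -> R) (w z : 'cV[R]_d)
    (dg df : R) :
  is_derive (f w) 1 g dg -> is_derive w z f df ->
  is_derive w z (fun u => g (f u)) (dg * df).
Proof.
move=> hg hf; apply/is_derive_at0.
apply: (@is_derive1_comp R g (fun v : R => f (w + v *: z))).
  by rewrite scale0r addr0.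
exact/is_derive_at0.
Qed.

Lemma is_derive_bigsum (V : normedModType R) (I : Type) (r : seq I)
    (P : pred I) (F : I -> V -> R) (dF : I -> R) (w z : V) :
  (forall i, P i -> is_derive w z (F i) (dF i)) ->
  is_derive w z (fun u => \sum_(i <- r | P i) F i u) (\sum_(i <- r | P i) dF i).
Proof.
move=> h; elim: r => [|i r ih].
  under eq_fun do rewrite big_nil; rewrite big_nil; exact: is_derive_cst.
rewrite big_cons; under eq_fun do rewrite big_cons.
by case: (boolP (P i)) => // /h hi; exact: is_deriveD.
Qed.

Lemma dotpE d (u v : 'cV[R]_d) : dotp u v = \sum_i u i 0 * v i 0.
Proof. by rewrite mxE; apply: eq_bigr => i _; rewrite mxE. Qed.

Lemma is_derive_dotp d (u w z : 'cV[R]_d) :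
  is_derive w z (fun v => dotp u v) (dotp u z).
Proof.
apply/is_derive_at0.
under eq_fun do rewrite mulmxDr linearZr_LR /= mxE [X in _ + X]mxE mulrC.
by apply: is_derive_eq; rewrite add0r mul1r [LHS]mulr1.
Qed.

(** * Continuity and integrals over the unit interval *)

Lemma continuous_mul (T : topologicalType) (f g : T -> R) :
  continuous f -> continuous g -> continuous (fun v => f v * g v).
Proof. by move=> cf cg v; apply: continuousM; [exact: cf|exact: cg]. Qed.

Lemma continuous_bigsum (T : topologicalType) (I : Type) (r : seq I) (P : pred I)
    (F : I -> T -> R) :
  (forall i, P i -> continuous (F i)) ->
  continuous (fun x => \sum_(i <- r | P i) F i x).
Proof.
move=> h; elim: r => [|i r ih].
  by under eq_fun do rewrite big_nil; apply: cst_continuous.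
under eq_fun do rewrite big_cons.
by case: (boolP (P i)) => // /h hi x; apply: continuousD; [exact: hi|exact: ih].
Qed.

Lemma integrable01 (f : R -> R) : continuous f ->
  (@lebesgue_measure R).-integrable `[0, 1] (EFin \o f).
Proof.
move=> cf; apply: continuous_compact_integrable; first exact: segment_compact.
exact: continuous_subspaceT.
Qed.

Lemma Rintegral01_bigsum (I : Type) (r : seq I) (F : I -> R -> R) :
  (forall i, continuous (F i)) ->
  Rintegral (@lebesgue_measure R) `[0, 1] (fun v => \sum_(i <- r) F i v) =
  \sum_(i <- r) Rintegral (@lebesgue_measure R) `[0, 1] (F i).
Proof.
move=> cF; elim: r => [|i r ih].
  rewrite big_nil; under eq_Rintegral do rewrite big_nil.
  by rewrite /Rintegral integral0.
rewrite big_cons -ih; under eq_Rintegral do rewrite big_cons.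
apply: RintegralD => //; apply: integrable01 => //.
exact: continuous_bigsum.
Qed.

Lemma quadE d (A : 'M[R]_d) (u v : 'cV[R]_d) :
  (u^T *m A *m v) 0 0 = \sum_i \sum_j u j 0 * v i 0 * A j i.
Proof.
rewrite mxE; apply: eq_bigr => i _; rewrite mxE big_distrl /=.
by apply: eq_bigr => j _; rewrite mxE; ring.
Qed.

(** The matrix integral is entrywise and the quadratic form is a finite linear combination of
    entries; continuity gives the integrability that linearity of the integral asks for. *)
Lemma quad_mxintegral01 d (A : R -> 'M[R]_d) (z : 'cV[R]_d) :
  (forall i j, continuous (fun v => A v i j)) ->
  (z^T *m mxintegral01 A *m z) 0 0 =
  Rintegral (@lebesgue_measure R) `[0, 1] (fun v => (z^T *m A v *m z) 0 0).
Proof.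
move=> cA; rewrite quadE; under eq_Rintegral do rewrite quadE.
have cZ (c : R) i j : continuous (fun v => c * A v i j).
  by apply: continuous_mul; [exact: cst_continuous|exact: cA].
rewrite Rintegral01_bigsum; last by move=> i; exact: continuous_bigsum.
apply: eq_bigr => i _; rewrite Rintegral01_bigsum//.
apply: eq_bigr => j _; rewrite mxE RintegralZl//.
exact: integrable01.
Qed.

(** * One-variable Taylor formula and first-order condition *)

Lemma is_derive_continuous (f : R -> R) (x df : R) :
  is_derive x 1 f df -> {for x, continuous f}.
Proof. by case=> h _; apply/differentiable_continuous/derivable1_diffP. Qed.

Lemma taylor2_Rintegral01 (g g1 g2 : R -> R) :
  (forall v : R, is_derive v 1 g (g1 v)) ->
  (forall v : R, is_derive v 1 g1 (g2 v)) ->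
  continuous g2 ->
  Rintegral (@lebesgue_measure R) `[0, 1]
    (fun v => (1 - v) * g2 v) = g 1 - g 0 - g1 0.
Proof.
move=> dg dg1 cg2; pose G v := g v + (1 - v) * g1 v.
have dG (v : R) : is_derive v 1 G ((1 - v) * g2 v).
  apply: is_derive_eq; rewrite /GRing.scale /=; ring.
have cG v : {for v, continuous G} by exact: is_derive_continuous (dG v).
have cf : continuous (fun v : R => (1 - v) * g2 v).
  by apply: continuous_mul => // v; exact: is_derive_continuous.
(* The weight [1 - v] removes [g1] at the right end, so [G 1 - G 0] is [g 1 - (g 0 + g1 0)]. *)
rewrite /Rintegral (@continuous_FTC2 _ _ G) //=; first by rewrite /G; ring.
- exact: continuous_subspaceT.
- split; first by move=> v _; case: (dG v).
  + by apply: cvg_at_right_filter; exact: cG.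
  + by apply: cvg_at_left_filter; exact: cG.
- by move=> v _; rewrite derive1E; case: (dG v).
Qed.

(** The two-sided limit of the quotients is also their limit from the right, where small [h] lies in
    the unit interval and the quotients are nonnegative. Minimality on one side only gives a sign,
    not a zero derivative. *)
Lemma derive_ge0_at_min (g : R -> R) (dg : R) : is_derive (0 : R) 1 g dg ->
  (forall v, 0 <= v <= 1 -> g 0 <= g v) -> 0 <= dg.
Proof.
move=> [dv <-] hmin.
apply: (@cvgr_to_ge _ (0 : R)^'+ _ _
  (fun h : R => h^-1 *: (g (h *: 1 + 0) - g 0))).
  exact: cvg_dnbhs_at_right.
near=> h; rewrite addr0 [h *: 1]mulr1; apply: mulr_ge0.
  by rewrite invr_ge0; near: h; exact: nbhs_right_ge.
by rewrite subr_ge0; apply: hmin; apply/andP; split; near: h;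
  [exact: nbhs_right_ge|exact: nbhs_right_le].
Unshelve. all: by end_near.
Qed.

(** * Hessians and the integrated quadratic form *)

(** The direction [v] of the second differentiation stands on the left of [M], matching the order of
    derivatives in [hessian]; basis vectors for [v] and [u] then read off the entry [i j]. *)
Lemma is_derive_hessian d (L : 'cV[R]_d -> R) (gr : 'cV[R]_d -> 'cV[R]_d)
    (M : 'cV[R]_d -> 'M[R]_d) :
  (forall w u : 'cV[R]_d, is_derive w u L (dotp (gr w) u)) ->
  (forall w u v : 'cV[R]_d,
    is_derive w v (fun w : 'cV[R]_d => dotp (gr w) u) ((v^T *m M w *m u) 0 0)) ->
  hessian L = M.
Proof.
move=> dL dgr; apply/funext => w; apply/matrixP => i j; rewrite mxE.
have -> : (fun u : 'cV[R]_d => 'D_(delta_mx j 0 : 'cV[R]_d) L u) =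
    (fun u : 'cV[R]_d => dotp (gr u) (delta_mx j 0 : 'cV[R]_d)).
  by apply/funext => u; case: (dL u (delta_mx j 0 : 'cV[R]_d)).
case: (dgr w (delta_mx j 0 : 'cV[R]_d) (delta_mx i 0 : 'cV[R]_d)) => _ ->.
by rewrite trmx_delta -rowE -colE !mxE.
Qed.

Lemma quad_integral_hessian d (L : 'cV[R]_d -> R) (gr : 'cV[R]_d -> 'cV[R]_d)
    (a z : 'cV[R]_d) :
  (forall w u : 'cV[R]_d, is_derive w u L (dotp (gr w) u)) ->
  (forall w u v : 'cV[R]_d,
    is_derive w v (fun w : 'cV[R]_d => dotp (gr w) u) ((v^T *m hessian L w *m u) 0 0)) ->
  (forall i j, continuous (fun v : R => hessian L (a + v *: z) i j)) ->
  (z^T *m mxintegral01 (fun v => (1 - v) *: hessian L (a + v *: z)) *m z) 0 0 =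
  L (a + z) - L a - dotp (gr a) z.
Proof.
move=> dL dgr cH; rewrite quad_mxintegral01; last first.
  move=> i j; under eq_fun do rewrite mxE.
  by apply: continuous_mul; [move=> v; exact: is_derive_continuous|exact: cH].
under eq_Rintegral do rewrite -scalemxAr -scalemxAl mxE.
(* Both endpoints are written as points of the line, the shape that the one-variable Taylor formula
   produces. *)
transitivity (L (a + 1 *: z) - L (a + 0 *: z) - dotp (gr (a + 0 *: z)) z); last first.
  by rewrite scale1r scale0r addr0.
apply: (@taylor2_Rintegral01 (fun v => L (a + v *: z))
  (fun v => dotp (gr (a + v *: z)) z)
  (fun v => (z^T *m hessian L (a + v *: z) *m z) 0 0)).
- by move=> v; apply/is_derive_line.
- by move=> v; apply/(@is_derive_line _ (fun w => dotp (gr w) z)).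
- under eq_fun do rewrite quadE.
  do 2 (apply: continuous_bigsum => ? _).
  by apply: continuous_mul; [exact: cst_continuous|exact: cH].
Qed.

(** * Gradient and Hessian of the multinomial logit loss *)

Section Mnl.
Context (d N : nat) (x : nat -> 'I_N -> 'cV[R]_d).

(** The expected feature of the chosen option; the outside option has feature 0 and contributes
    nothing to the sum. *)
Definition mnl_mean (s : nat) (S : {set 'I_N}) (w : 'cV[R]_d) : 'cV[R]_d :=
  \sum_(j in S) mnl_prob x s (Some j) S w *: x s j.

Lemma mnl_normalizer_gt0 (s : nat) (S : {set 'I_N}) (w : 'cV[R]_d) :
  0 < 1 + \sum_(j in S) expR (dotp (x s j) w).
Proof. by rewrite ltr_pwDl// sumr_ge0// => j _; exact: expR_ge0. Qed.

Lemma mnl_prob_gt0 (s : nat) (i : option 'I_N) (S : {set 'I_N}) (w : 'cV[R]_d) :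
  0 < mnl_prob x s i S w.
Proof. by rewrite divr_gt0 ?expR_gt0 ?mnl_normalizer_gt0. Qed.

Lemma dotpBl (a b c : 'cV[R]_d) : dotp (a - b) c = dotp a c - dotp b c.
Proof. by rewrite linearB mulmxBl mxE [X in _ + X]mxE. Qed.

Lemma dotpZl (k : R) (a c : 'cV[R]_d) : dotp (k *: a) c = k * dotp a c.
Proof. by rewrite linearZ -scalemxAl mxE. Qed.

Lemma dotp_suml (I : Type) (r : seq I) (P : pred I) (F : I -> 'cV[R]_d)
    (c : 'cV[R]_d) :
  dotp (\sum_(i <- r | P i) F i) c = \sum_(i <- r | P i) dotp (F i) c.
Proof. by rewrite linear_sum mulmx_suml summxE. Qed.

Lemma quadZ (k : R) (A : 'M[R]_d) (u v : 'cV[R]_d) :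
  (u^T *m (k *: A) *m v) 0 0 = k * (u^T *m A *m v) 0 0.
Proof. by rewrite -scalemxAr -scalemxAl mxE. Qed.

Lemma quad_sum (I : Type) (r : seq I) (P : pred I) (F : I -> 'M[R]_d)
    (u v : 'cV[R]_d) :
  (u^T *m (\sum_(i <- r | P i) F i) *m v) 0 0 =
  \sum_(i <- r | P i) (u^T *m F i *m v) 0 0.
Proof. by rewrite mulmx_sumr mulmx_suml summxE. Qed.

Lemma quad_outer (a b u v : 'cV[R]_d) :
  (u^T *m (a *m b^T) *m v) 0 0 = dotp a u * dotp b v.
Proof.
rewrite mulmxA -mulmxA mxE big_ord1; congr (_ * _).
by rewrite !dotpE; apply: eq_bigr => i _; rewrite mulrC.
Qed.

(** Differentiating the numerator produces the feature of [i]. Differentiating the inverse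
    normaliser produces minus the exponentially weighted feature sum over the normaliser, which is
    minus [mnl_mean]. *)
Lemma is_derive_mnl_prob (s : nat) (i : option 'I_N) (S : {set 'I_N})
    (w z : 'cV[R]_d) :
  is_derive w z (mnl_prob x s i S)
    (mnl_prob x s i S w * dotp (feature x s i - mnl_mean s S w) z).
Proof.
have dexp (a : 'cV[R]_d) :
    is_derive w z (fun u => expR (dotp a u)) (expR (dotp a w) * dotp a z).
  by apply: (@is_derive_chain d expR (fun u => dotp a u)); exact: is_derive_dotp.
have Z0 := mnl_normalizer_gt0 s S w.
pose Z (u : 'cV[R]_d) := 1 + \sum_(j in S) expR (dotp (x s j) u).
have dZ : is_derive w z Z (\sum_(j in S) expR (dotp (x s j) w) * dotp (x s j) z).
  apply: is_derive_eq.
    apply: is_deriveD; apply: is_derive_bigsum => j _; exact: dexp.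
  by rewrite add0r.
have dV : is_derive w z (fun u => (Z u)^-1)
    (- (Z w) ^- 2 *
      (\sum_(j in S) expR (dotp (x s j) w) * dotp (x s j) z)).
  apply: (@is_derive_chain d (fun r => r^-1)) => //.
  apply: is_derive_eq; first by apply: is_deriveV; rewrite gt_eqF.
  by rewrite /GRing.scale /= mulr1.
have pE : mnl_prob x s i S =
    (fun u => expR (dotp (feature x s i) u)) * (fun u => (Z u)^-1).
  by [].
have := is_deriveM (dexp (feature x s i)) dV; rewrite -pE => dp.
apply: is_derive_eq dp _.
rewrite /GRing.scale /= dotpBl dotp_suml /mnl_prob -/(Z w).
(* The common factor [(Z w)^-1] is pulled out of the mean, leaving a field identity with one
   unexpanded sum. *)
under [in RHS]eq_bigr do rewrite dotpZl mulrAC.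
rewrite -mulr_suml; field; exact: lt0r_neq0.
Qed.

Lemma is_derive_ln_mnl_prob (s : nat) (i : option 'I_N) (S : {set 'I_N})
    (w z : 'cV[R]_d) :
  is_derive w z (fun u => ln (mnl_prob x s i S u))
    (dotp (feature x s i - mnl_mean s S w) z).
Proof.
have p0 := mnl_prob_gt0 s i S w.
apply: is_derive_eq.
  apply: (@is_derive_chain d (@ln R)); [exact: is_derive1_ln|exact: is_derive_mnl_prob].
by rewrite mulrA mulVf ?mul1r// gt_eqF.
Qed.

Variables (S : nat -> {set 'I_N}) (y : nat -> option 'I_N -> bool).

Definition round_grad (s : nat) (w : 'cV[R]_d) : 'cV[R]_d :=
  \sum_(i in choices (S s)) (y s i)%:R *: (mnl_mean s (S s) w - feature x s i).

(** The inner sum is the covariance matrix of the chosen feature: the probability-weighted features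
    sum to the mean, so it equals the second moment minus the outer square of the mean. With exactly
    one choice made, the outer weights sum to 1. *)
Definition round_hess (s : nat) (w : 'cV[R]_d) : 'M[R]_d :=
  \sum_(i in choices (S s)) (y s i)%:R *:
    \sum_(j in S s) mnl_prob x s (Some j) (S s) w *:
      ((x s j - mnl_mean s (S s) w) *m (x s j)^T).

Lemma is_derive_round_loss (s : nat) (w z : 'cV[R]_d) :
  is_derive w z (round_loss x S y s) (dotp (round_grad s w) z).
Proof.
apply: is_derive_eq.
  apply: is_deriveN; apply: is_derive_bigsum => i _.
  apply: is_deriveM; exact: is_derive_ln_mnl_prob.
rewrite dotp_suml -sumrN; apply: eq_bigr => i _.
by rewrite dotpZl !dotpBl /GRing.scale /=; ring.
Qed.

(** Only the mean depends on [w]; its derivative comes from that of each probability, and each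
    product of two inner products is an outer-product quadratic form. *)
Lemma is_derive_round_grad (s : nat) (w u v : 'cV[R]_d) :
  is_derive w v (fun w : 'cV[R]_d => dotp (round_grad s w) u)
    ((v^T *m round_hess s w *m u) 0 0).
Proof.
under eq_fun do rewrite dotp_suml.
rewrite quad_sum; apply: is_derive_bigsum => i _.
under eq_fun do rewrite dotpZl dotpBl dotp_suml.
apply: is_derive_eq.
  apply: is_deriveM; apply: is_deriveB; apply: is_derive_bigsum => j _.
  under eq_fun do rewrite dotpZl.
  apply: is_deriveM; exact: is_derive_mnl_prob.
rewrite quadZ quad_sum /GRing.scale /= mulr0 addr0 subr0; congr (_ * _).
apply: eq_bigr => j _; rewrite mulr0 add0r quadZ quad_outer; ring.
Qed.

(** The entries are polynomials in the choice probabilities, which are derivable along the line and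
    hence continuous. *)
Lemma continuous_round_hess_line (s : nat) (a z : 'cV[R]_d) i j :
  continuous (fun v : R => round_hess s (a + v *: z) i j).
Proof.
have cp k : continuous (fun v : R => mnl_prob x s k (S s) (a + v *: z)).
  move=> v; apply: is_derive_continuous; apply/is_derive_line.
  exact: is_derive_mnl_prob.
have cm k : continuous (fun v : R => mnl_mean s (S s) (a + v *: z) k 0).
  under eq_fun do rewrite summxE.
  apply: continuous_bigsum => l _; under eq_fun do rewrite mxE.
  by apply: continuous_mul; [exact: cp|exact: cst_continuous].
under eq_fun do rewrite summxE.
apply: continuous_bigsum => k _; under eq_fun do rewrite mxE summxE.
apply: continuous_mul; first exact: cst_continuous.
apply: continuous_bigsum => l _.
under eq_fun do rewrite mxE mxE big_ord1 !mxE.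
apply: continuous_mul; first exact: cp.
apply: continuous_mul; last exact: cst_continuous.
by move=> v; apply: continuousB; [exact: cst_continuous|exact: cm].
Qed.

Definition cum_grad (t : nat) (w : 'cV[R]_d) : 'cV[R]_d :=
  \sum_(1 <= s < t) round_grad s w.

Lemma is_derive_cum_loss (t : nat) (w z : 'cV[R]_d) :
  is_derive w z (cum_loss x S y t) (dotp (cum_grad t w) z).
Proof.
rewrite dotp_suml; apply: is_derive_bigsum => s _; exact: is_derive_round_loss.
Qed.

Lemma is_derive_cum_grad (t : nat) (w u v : 'cV[R]_d) :
  is_derive w v (fun w : 'cV[R]_d => dotp (cum_grad t w) u)
    ((v^T *m (\sum_(1 <= s < t) round_hess s w) *m u) 0 0).
Proof.
under eq_fun do rewrite dotp_suml.
rewrite quad_sum; apply: is_derive_bigsum => s _.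
exact: is_derive_round_grad.
Qed.

Lemma hessian_cum_loss (t : nat) :
  hessian (cum_loss x S y t) = fun w => \sum_(1 <= s < t) round_hess s w.
Proof.
exact: is_derive_hessian (is_derive_cum_loss t) (is_derive_cum_grad t).
Qed.

Lemma quad_integral_hessian_cum_loss (t : nat) (a z : 'cV[R]_d) :
  let L := cum_loss x S y t in
  (z^T *m mxintegral01 (fun v => (1 - v) *: hessian L (a + v *: z)) *m z) 0 0 =
  L (a + z) - L a - dotp (cum_grad t a) z.
Proof.
apply: quad_integral_hessian.
- exact: is_derive_cum_loss.
- by rewrite hessian_cum_loss; exact: is_derive_cum_grad.
- rewrite hessian_cum_loss => i j; under eq_fun do rewrite summxE.
  by apply: continuous_bigsum => s _; exact: continuous_round_hess_line.
Qed.

End Mnl.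

(** * Weighted norms and Euclidean balls *)

(** As [Num.sqrt] is 0 on negative numbers, the squared [mxnorm] is the positive part of the
    quadratic form; [0 <= c] settles the negative case. *)
Lemma sqr_mxnorm_le d (A : 'M[R]_d) (z : 'cV[R]_d) (c : R) :
  0 <= c -> (z^T *m A *m z) 0 0 <= c -> mxnorm A z ^+ 2 <= c.
Proof.
move=> c0 qc; rewrite /mxnorm; case: (lerP 0 ((z^T *m A *m z) 0 0)) => q0.
  by rewrite sqr_sqrtr.
by rewrite ler0_sqrtr ?(ltW q0)// expr0n.
Qed.

Lemma quad_le_sqr_mxnorm d (A : 'M[R]_d) (z : 'cV[R]_d) :
  (z^T *m A *m z) 0 0 <= mxnorm A z ^+ 2.
Proof.
rewrite /mxnorm; case: (lerP 0 ((z^T *m A *m z) 0 0)) => q0.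
  by rewrite sqr_sqrtr.
exact: le_trans (ltW q0) (sqr_ge0 _).
Qed.

Lemma norm2_leE d (w : 'cV[R]_d) (B : R) : 0 <= B ->
  (norm2 w <= B) = (\sum_i w i 0 ^+ 2 <= B ^+ 2).
Proof.
by move=> B0; rewrite /norm2 -{1}(ger0_norm B0) -sqrtr_sqr ler_sqrt// sqr_ge0.
Qed.

(** Convexity of the square in each coordinate: the gap is [v * (1 - v) * (a i 0 - b i 0) ^+ 2]. *)
Lemma ball2_convex d (B : R) (a b : 'cV[R]_d) (v : R) : 0 <= B ->
  ball2 B a -> ball2 B b -> 0 <= v <= 1 -> ball2 B (a + v *: (b - a)).
Proof.
move=> B0; rewrite /ball2 /= !norm2_leE// => ha hb /andP[v0 v1].
have -> : B ^+ 2 = (1 - v) * B ^+ 2 + v * B ^+ 2 by ring.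
apply: (@le_trans _ _
  ((1 - v) * (\sum_i a i 0 ^+ 2) + v * (\sum_i b i 0 ^+ 2))).
  rewrite !mulr_sumr -big_split /=; apply: ler_sum => i _; rewrite !mxE.
  have v1' : 0 <= 1 - v by rewrite subr_ge0.
  by have := mulr_ge0 (mulr_ge0 v0 v1') (sqr_ge0 (a i 0 - b i 0)); nra.
by apply: lerD; apply: ler_wpM2l => //; rewrite subr_ge0.
Qed.

Lemma sum_sqr_sub_le d (B : R) (a b : 'cV[R]_d) : 0 <= B ->
  ball2 B a -> ball2 B b -> \sum_i (a - b) i 0 ^+ 2 <= 4 * B ^+ 2.
Proof.
move=> B0; rewrite /ball2 /= !norm2_leE// => ha hb.
apply: (@le_trans _ _ (2 * (\sum_i a i 0 ^+ 2) + 2 * (\sum_i b i 0 ^+ 2)));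
  last by lra.
rewrite !mulr_sumr -big_split /=; apply: ler_sum => i _; rewrite !mxE.
(* The coordinate bound [(a - b)^2 <= 2 a^2 + 2 b^2] amounts to [0 <= (a + b)^2]. *)
by have := sqr_ge0 (a i 0 + b i 0); nra.
Qed.

Lemma quadD d (A C : 'M[R]_d) (z : 'cV[R]_d) :
  (z^T *m (A + C) *m z) 0 0 = (z^T *m A *m z) 0 0 + (z^T *m C *m z) 0 0.
Proof. by rewrite mulmxDr mulmxDl mxE. Qed.

Lemma quad_scalar d (k : R) (z : 'cV[R]_d) :
  (z^T *m k%:M *m z) 0 0 = k * \sum_i z i 0 ^+ 2.
Proof.
rewrite -scalemx1 -scalemxAr -scalemxAl mxE mulmx1 dotpE.
by congr (_ * _); apply: eq_bigr => i _; rewrite expr2.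
Qed.

(** * Size of the confidence radius *)

Lemma betasq_ge0 d (B : R) (t : nat) (delta : R) :
  0 < delta <= 1 -> 0 <= betasq d B t delta.
Proof.
move=> /andP[d0 d1]; rewrite /betasq addr_ge0//.
  by rewrite ln_ge0// div1r invf_ge1.
rewrite mulr_ge0// ln_ge0// le_max; apply/orP; left.
by rewrite -expR0 ler_expR.
Qed.

Lemma ln_max_le (d t : nat) (B : R) : (0 < d)%N -> 1 <= B -> (2 <= t)%N ->
  ln (Num.max (expR 1) (4 * expR 1 * B * (t%:R - 1) / d%:R)) <=
  ln 4 + 1 + ln (B * t%:R).
Proof.
move=> d0 B1 t2.
have t1 : (1 : R) <= t%:R by rewrite ler1n; exact: ltnW.
have d1 : (1 : R) <= d%:R by rewrite ler1n.
have e0 : 0 < expR 1 :> R := expR_gt0 1.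
have Bt1 : 1 <= B * t%:R by rewrite mulr_ege1.
have Bt0 : 0 < B * t%:R by exact: lt_le_trans Bt1.
have -> : ln 4 + 1 + ln (B * t%:R) = ln (4 * expR 1 * (B * t%:R)).
  have e4 : ln (4 * expR 1) = ln 4 + 1 :> R by rewrite lnM ?posrE// expRK.
  by rewrite -e4 -lnM ?posrE// mulr_gt0.
rewrite ler_ln ?posrE; [|by rewrite lt_max e0|];
  last by apply: mulr_gt0 => //; exact: mulr_gt0.
(* Both arguments of the maximum are below [4 * expR 1 * (B * t%:R)]: the first because
   [B * t%:R >= 1], the second because [t - 1 <= t] and [d >= 1]. *)
rewrite ge_max; apply/andP; split; first by nra.
rewrite ler_pdivrMr ?(lt_le_trans _ d1)//.
apply: (@le_trans _ _ (4 * expR 1 * (B * t%:R))).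
  rewrite [leRHS]mulrA; apply: ler_wpM2l; last by rewrite lerBlDr lerDl.
  by rewrite !mulr_ge0// ltW// (lt_le_trans _ B1).
by rewrite ler_peMr// ltW// mulr_gt0// mulr_gt0.
Qed.

Lemma betasq_bigO (delta : R) : 0 < delta <= 1 ->
  exists C : R, forall (d : nat) (B : R) (t : nat),
    (0 < d)%N -> 1 <= B -> (2 <= t)%N ->
    `|2 * betasq d B t delta + 1| <= C * (d%:R * ln (B * t%:R)).
Proof.
move=> hdelta.
have ln2 : 0 < ln 2 :> R by rewrite ln_gt0// ltr1n.
have lnd : 0 <= ln (1 / delta).
  by move: hdelta => /andP[d0 d1]; rewrite ln_ge0// div1r invf_ge1.
have ln4 : 0 <= ln 4 :> R by rewrite ln_ge0// ler1n.
(* [c0] collects the terms of the bound free of [ln (B * t%:R)]. Since that logarithm is at least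
   [ln 2], dividing by [ln 2] absorbs them; the extra 2 in the witness is the coefficient of
   [d%:R * ln (B * t%:R)]. *)
pose c0 : R := 2 * ln (1 / delta) + 1 + 2 * (ln 4 + 1).
exists (c0 / ln 2 + 2) => d B t d0 B1 t2.
rewrite ger0_norm; last by rewrite addr_ge0// mulr_ge0// betasq_ge0.
have d1 : (1 : R) <= d%:R by rewrite ler1n.
have t2R : (2 : R) <= t%:R by rewrite ler_nat.
have lnBt : ln 2 <= ln (B * t%:R).
  by rewrite ler_ln ?posrE; nra.
have hm := ln_max_le d t B d0 B1 t2.
rewrite /betasq.
set m := ln (Num.max _ _) in hm *; set l := ln (B * t%:R) in lnBt hm *.
have c0_ge0 : 0 <= c0 by rewrite /c0; lra.
have c0l : c0 <= c0 / ln 2 * l by rewrite -mulrA ler_peMr// ler_pdivlMl// mulr1.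
(* Everything is scaled by [d], with [d >= 1] covering the term that lacks this factor, so the final
   comparison is linear in the products. *)
have h1 : d%:R * m <= d%:R * (ln 4 + 1 + l) by rewrite ler_wpM2l.
have h2 : d%:R * c0 <= d%:R * (c0 / ln 2 * l) by rewrite ler_wpM2l.
have h3 : 2 * ln (1 / delta) + 1 <= d%:R * (2 * ln (1 / delta) + 1).
  by rewrite ler_peMl//; lra.
rewrite (_ : _ * (d%:R * l) = d%:R * (c0 / ln 2 * l) + 2 * (d%:R * l)); last by ring.
apply: le_trans (lerD h2 (lexx _)); rewrite /c0; lra.
Qed.

End RegularizedQuadraticBound.

Theorem lemmaF2 (R : realType) (delta : R) (hdelta : 0 < delta <= 1) :
  (forall (d N K : nat) (B : R) (x : nat -> 'I_N -> 'cV[R]_d)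
      (S : nat -> {set 'I_N}) (y : nat -> option 'I_N -> bool)
      (wstar : 'cV[R]_d),
    (0 < d)%N -> 0 < B ->
    (forall s, (1 <= s)%N -> (#|S s| <= K)%N) ->
    (forall s, (1 <= s)%N -> #|[set i in choices (S s) | y s i]| = 1%N) ->
    (forall s i, (1 <= s)%N -> norm2 (x s i) <= 1) ->
    norm2 wstar <= B ->
    forall (t : nat) (what nu : 'cV[R]_d),
      (1 <= t)%N ->
      let L := cum_loss x S y t in
      let lambda : R := 1 / (8 * B ^+ 2) in
      let H := hessian L nu + lambda%:M in
      argmin_on (ball2 B) L what ->
      1 / 2 * mxnorm (hessian L nu) (wstar - what) ^+ 2 =
        mxnorm (mxintegral01
          (fun v => (1 - v) *: hessian L (what + v *: (wstar - what))))
          (wstar - what) ^+ 2 ->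
      conf_set B L what t delta wstar ->
      mxnorm H (wstar - what) ^+ 2 <= 2 * betasq d B t delta + 1)
  /\
  (exists C : R, forall (d : nat) (B : R) (t : nat),
    (0 < d)%N -> 1 <= B -> (2 <= t)%N ->
    `|2 * betasq d B t delta + 1| <= C * (d%:R * ln (B * t%:R))).
Proof.
split; last exact: betasq_bigO.
move=> d N K B x S y wstar _ B0 _ _ _ hw t what nu _ L lambda H [hwhat hmin] hnu [_ hconf].
set z := wstar - what in hnu *.
have beta0 : 0 <= betasq d B t delta by exact: betasq_ge0.
have zE : what + z = wstar by rewrite /z addrC subrK.
have B_ge0 := ltW B0.
(* First-order optimality along the segment from [what] to [wstar], which stays in the ball by
   convexity. *)
have grad0 : 0 <= ((cum_grad R d N x S y t what)^T *m z) 0 0.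
  apply: (@derive_ge0_at_min R (fun v => L (what + v *: z))).
    by apply/is_derive_at0; exact: is_derive_cum_loss.
  by move=> v v01; rewrite scale0r addr0; apply: hmin; exact: ball2_convex.
have hint : mxnorm (mxintegral01
    (fun v => (1 - v) *: hessian L (what + v *: z))) z ^+ 2 <= betasq d B t delta.
  apply: sqr_mxnorm_le => //; rewrite quad_integral_hessian_cum_loss -/L zE; lra.
have hz : lambda * \sum_i z i 0 ^+ 2 <= 1 / 2.
  have := sum_sqr_sub_le R d B _ _ B_ge0 hw hwhat; rewrite -/z => hz.
  rewrite /lambda mulrAC ler_pdivrMr; nra.
apply: sqr_mxnorm_le; first by lra.
rewrite quadD quad_scalar.
(* The factor [1 / 2] in [hnu] turns [hint] into a bound by twice [betasq] on the form at [nu]; with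
   [hz] the total is at most [2 * betasq d B t delta + 1 / 2]. *)
have := quad_le_sqr_mxnorm R d (hessian L nu) z; lra.
Qed.
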